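(* There exist genuinely entangled $6$-qubit states that satisfy the Bell property, and there exist genuinely entangled $8$-qubit states that satisfy the strong Bell property.
   Context: An $n$-qubit state is a nonzero vector $|\Psi\rangle=\sum_{x\in\{0,1\}^n}\Psi(x)|x\rangle\in(\mathbb{C}^2)^{\otimes n}$; states are considered up to nonzero scalar multiples. A state is genuinely entangled if it cannot be written (up to permutation of qubits) as a tensor product of states of two nonempty proper subsets of the qubits. For qubits $i\neq j$ and $a,b\in\{0,1\}$, $|\Psi^{ab}_{ij}\rangle$ is the $(n-2)$-qubit vector obtained by fixing qubits $i,j$ to $a,b$. The Bell states are $|\phi^{\pm}\rangle=|00\rangle\pm|11\rangle$ and $|\psi^{\pm}\rangle=|01\rangle\pm|10\rangle$. For a 2-qubit state $|\phi\rangle=\sum_{a,b}c_{ab}|ab\rangle$, define $\langle\phi|_{ij}|\Psi\rangle=\sum_{a,b}\overline{c_{ab}}\,|\Psi^{ab}_{ij}\rangle$ (e.g. $\langle\phi^+|_{ij}|\Psi\rangle=|\Psi^{00}_{ij}\rangle+|\Psi^{11}_{ij}\rangle$, $\langle\psi^-|_{ij}|\Psi\rangle=|\Psi^{01}_{ij}\rangle-|\Psi^{10}_{ij}\rangle$). A genuinely entangled state $|\Psi\rangle$ satisfies the Bell property if for every pair of qubits $i\neq j$ and every Bell state $|\phi\rangle$, $\langle\phi|_{ij}|\Psi\rangle$ is (up to a nonzero scalar) a tensor product of Bell states over some pairing of the remaining qubits; it satisfies the strong Bell property if for every $i\neq j$ and every Bell state $|\phi\rangle$, $\langle\phi|_{ij}|\Psi\rangle$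 is (up to a nonzero scalar) $|\phi\rangle\otimes\cdots\otimes|\phi\rangle$ over some pairing of the remaining qubits. *)

(* Defs.v *)
From HB Require Import structures.
From mathcomp Require Import all_boot all_order all_algebra.
From mathcomp Require Import reals.
From mathcomp Require Export complex.

Set Implicit Arguments.
Unset Strict Implicit.
Unset Printing Implicit Defensive.

Import GRing.Theory Num.Theory.
Local Open Scope ring_scope.

(* Vectors of the tensor power of C^2 whose factors (the qubits) are labelled
   by a finite type Q, given by their amplitudes Psi(x), x in {0,1}^Q.
   The bit 1 is encoded by true. *)
Definition qvec (C : numClosedFieldType) (Q : finType) : Type :=
  {ffun {ffun Q -> bool} -> C}.

Definition is_state (C : numClosedFieldType) (Q : finType)
    (Psi : qvec C Q) : Prop :=
  exists x : {ffun Q -> bool}, Psi x != 0.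

Definition same_state (C : numClosedFieldType) (Q : finType)
    (Phi Psi : qvec C Q) : Prop :=
  exists2 c : C, c != 0 & forall x : {ffun Q -> bool}, Phi x = c * Psi x.

Definition subword (Q : finType) (P : pred Q) (x : {ffun Q -> bool}) :
    {ffun {q : Q | P q} -> bool} :=
  [ffun q => x (val q)].

Definition tensor (C : numClosedFieldType) (Q : finType) (S : {set Q})
    (Phi : qvec C {q : Q | q \in S}) (Chi : qvec C {q : Q | q \notin S}) :
    qvec C Q :=
  [ffun x => Phi (subword (fun q => q \in S) x)
           * Chi (subword (fun q => q \notin S) x)].

Definition genuinely_entangled (C : numClosedFieldType) (Q : finType)
    (Psi : qvec C Q) : Prop :=
  is_state Psi /\
  ~ (exists S : {set Q}, [/\ S != set0, S != setT &
      exists (Phi : qvec C {q : Q | q \in S})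
             (Chi : qvec C {q : Q | q \notin S}),
        [/\ is_state Phi, is_state Chi & Psi = tensor Phi Chi]]).

(* Two-qubit vectors \sum_{a,b} c_{ab} |ab>, on an ordered pair of qubits. *)
Definition qvec2 (C : numClosedFieldType) : Type := {ffun bool * bool -> C}.

Definition ket2 (C : numClosedFieldType) (a b : bool) : qvec2 C :=
  [ffun p => (p == (a, b))%:R].

Definition bell_states (C : numClosedFieldType) : seq (qvec2 C) :=
  [:: ket2 C false false + ket2 C true true;
      ket2 C false false - ket2 C true true;
      ket2 C false true + ket2 C true false;
      ket2 C false true - ket2 C true false].

Definition others (Q : finType) (i j : Q) : finType :=
  {q : Q | (q != i) && (q != j)}.

(* Only used for i != j. *)
Definition extend (Q : finType) (i j : Q) (a b : bool)
    (y : {ffun others i j -> bool}) : {ffun Q -> bool} :=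
  [ffun q => if (insub q : option (others i j)) is Some r then y r
             else if q == i then a else b].

Definition slice (C : numClosedFieldType) (Q : finType) (Psi : qvec C Q)
    (i j : Q) (a b : bool) : qvec C (others i j) :=
  [ffun y => Psi (extend a b y)].

Definition contract (C : numClosedFieldType) (Q : finType)
    (phi : qvec2 C) (i j : Q) (Psi : qvec C Q) : qvec C (others i j) :=
  [ffun y => \sum_(a : bool) \sum_(b : bool)
               (phi (a, b))^* * slice Psi i j a b y].

(* The pairs are oriented only because a two-qubit vector lives on an ordered
   pair; reversing a pair changes a Bell state by at most a sign. *)
Definition pairing (Q : finType) (M : {set Q * Q}) : Prop :=
  (forall p : Q * Q, p \in M -> p.1 != p.2) /\
  (forall q : Q, #|[set p in M | (q == p.1) || (q == p.2)]| = 1%N).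

Definition pair_tensor (C : numClosedFieldType) (Q : finType)
    (M : {set Q * Q}) (phi : Q * Q -> qvec2 C) : qvec C Q :=
  [ffun x : {ffun Q -> bool} => \prod_(p in M) phi p (x p.1, x p.2)].

Definition bell_property (C : numClosedFieldType) (Q : finType)
    (Psi : qvec C Q) : Prop :=
  forall (i j : Q), i != j ->
  forall phi : qvec2 C, phi \in bell_states C ->
  exists (M : {set others i j * others i j})
         (beta : others i j * others i j -> qvec2 C),
    [/\ pairing M,
        forall p, p \in M -> beta p \in bell_states C &
        same_state (contract phi i j Psi) (pair_tensor M beta)].

Definition strong_bell_property (C : numClosedFieldType) (Q : finType)
    (Psi : qvec C Q) : Prop :=
  forall (i j : Q), i != j ->
  forall phi : qvec2 C, phi \in bell_states C ->
  exists M : {set others i j * others i j},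
    pairing M /\
    same_state (contract phi i j Psi) (pair_tensor M (fun=> phi)).

(* Main.v *)
Require Import Defs.
From mathcomp Require Import all_boot all_order all_algebra.
From mathcomp Require Import reals complex.

(** Both states have integer amplitudes. With x_1, ..., x_n the bits of x, the
    6-qubit state is supported on the words of even parity, where its amplitude
    is (-1)^(x1 x2 + x2 x3 + x1 x3 + x1 x4 + x2 x5 + x3 x6); the 8-qubit state is
    the indicator function of the [8,4,4] extended Hamming code. For each pair of
    qubits and each Bell state, a suitable pairing is found by exhaustive search
    over the integers.

    Genuine entanglement: suppose the amplitudes at 0 and w are nonzero. If the
    state is a product across S, then the amplitude at the word equal to w on S
    and to 0 off S is nonzero too. For i in S and j not in S, this is violated by
    a word w of minimal nonzero weight in the support with w_i = w_j = 1. *)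

Import GRing.Theory Num.Theory.
Local Open Scope ring_scope.

(** * Bit words and decidable forms of the properties *)

Fixpoint words (n : nat) : seq (seq bool) :=
  if n is m.+1 then [seq b :: w | b <- [:: false; true], w <- words m]
  else [:: [::]].

Lemma mem_words (w : seq bool) : w \in words (size w).
Proof.
elim: w => [|b w IHw]; first by [].
by apply/allpairsP; exists (b, w); split=> //; case: b.
Qed.

Lemma size_words (n : nat) (w : seq bool) : w \in words n -> size w = n.
Proof.
elim: n w => [|n IHn] w; first by rewrite inE => /eqP ->.
by case/allpairsP => -[b v] [_ /IHn /= <- ->].
Qed.

Definition put (w : seq bool) (i j : nat) (a b : bool) : seq bool :=
  mkseq (fun k => if k == i then a else if k == j then b else nth false w k)
    (size w).

(* The labels (s, t) = (0,0), (0,1), (1,0), (1,1) stand for phi+, phi-, psi+,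
   psi-: the Bell state is the sum over a of (-1)^(ta) |a, a + s>. *)
Definition bell_amp (st : bool * bool) (p : bool * bool) : int :=
  if p.1 (+) p.2 == st.1 then (-1) ^+ (st.2 && p.1) else 0.

Definition contract_amp (f : seq bool -> int) (st : bool * bool) (i j : nat)
    (w : seq bool) : int :=
  f (put w i j false st.1) + (-1) ^+ st.2 * f (put w i j true (~~ st.1)).

Definition pairs_amp (L : seq (nat * nat)) (b : nat * nat -> bool * bool)
    (w : seq bool) : int :=
  foldr *%R 1
    [seq bell_amp (b p) (nth false w p.1, nth false w p.2) | p <- L].

Definition rest (n i j : nat) : seq nat :=
  [seq q <- iota 0 n | (q != i) && (q != j)].

(** The lists produced by [matchings] are tested again with this predicate, so the correctness of
    that enumeration need not be proved. *)
Definition is_matching (r : seq nat) (L : seq (nat * nat)) : bool :=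
  [&& uniq L,
      all (fun p => [&& p.1 != p.2, p.1 \in r & p.2 \in r]) L &
      all (fun q => count (fun p => (q == p.1) || (q == p.2)) L == 1%N) r].

(* [&&] and [||] are strict under [vm_compute], so that the library's [all] and
   [has] would always scan the whole list. *)
Fixpoint all_lazy {T : Type} (a : pred T) (s : seq T) : bool :=
  if s is x :: s' then if a x then all_lazy a s' else false else true.

Lemma all_lazyE (T : Type) (a : pred T) (s : seq T) : all_lazy a s = all a s.
Proof. by elim: s => //= x s ->. Qed.

Fixpoint has_lazy {T : Type} (a : pred T) (s : seq T) : bool :=
  if s is x :: s' then if a x then true else has_lazy a s' else false.

Lemma has_lazyE (T : Type) (a : pred T) (s : seq T) : has_lazy a s = has a s.
Proof. by elim: s => //= x s ->. Qed.

(* [contract_amp] overwrites bits i and j, so only words where they vanish matter. *)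
Definition contraction (n : nat) (f : seq bool -> int) (st : bool * bool)
    (i j : nat) : seq (seq bool * int) :=
  [seq (w, contract_amp f st i j w) |
     w <- words n & ~~ nth false w i && ~~ nth false w j].

(** Contractions of both states have amplitudes between -2 and 2, products of Bell states have
    amplitudes 0, 1 and -1, so these nonzero scalars suffice. *)
Definition is_pairs (v : seq (seq bool * int)) (L : seq (nat * nat))
    (b : nat * nat -> bool * bool) : bool :=
  has_lazy (fun c : int => all_lazy (fun u => u.2 == c * pairs_amp L b u.1) v)
    [:: 1; -1; 2; -2].

(* The first argument only bounds the recursion depth. *)
Fixpoint matchings (m : nat) (r : seq nat) : seq (seq (nat * nat)) :=
  if m is m'.+1 then
    if r is x :: r' then
      flatten [seq [seq (x, y) :: L | L <- matchings m' (rem y r')] | y <- r']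
    else [:: [::]]
  else [:: [::]].

Definition labels : seq (bool * bool) :=
  [:: (false, false); (false, true); (true, false); (true, true)].

Definition forall_pairs (n : nat) (P : nat -> nat -> bool) : bool :=
  all_lazy (fun i =>
    all_lazy (fun j => if i == j then true else P i j) (iota 0 n)) (iota 0 n).

Lemma forall_pairsP (n : nat) (P : nat -> nat -> bool) :
  forall_pairs n P -> forall i j : 'I_n, i != j -> P i j.
Proof.
rewrite /forall_pairs all_lazyE => /allP H i j ij.
have ord_iota (k : 'I_n) : (k : nat) \in iota 0 n by rewrite mem_iota ltn_ord.
move: (H _ (ord_iota i)); rewrite all_lazyE => /allP/(_ _ (ord_iota j)).
by rewrite ifN.
Qed.

(** Six qubits leave two pairs after a contraction, hence two labels, assigned by position in
    [L]. *)
Definition bell_check (n : nat) (f : seq bool -> int) : bool :=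
  forall_pairs n (fun i j => all_lazy (fun st =>
    let v := contraction n f st i j in
    has_lazy (fun L => if is_matching (rest n i j) L then
      has_lazy (fun l : seq (bool * bool) =>
           is_pairs v L (fun p => nth (false, false) l (index p L)))
         [seq [:: l1; l2] | l1 <- labels, l2 <- labels] else false)
      (matchings n (rest n i j))) labels).

Definition strong_bell_check (n : nat) (f : seq bool -> int) : bool :=
  forall_pairs n (fun i j => all_lazy (fun st =>
    let v := contraction n f st i j in
    has_lazy (fun L => if is_matching (rest n i j) L then
                is_pairs v L (fun=> st) else false)
      (matchings n (rest n i j))) labels).

(** Bipartitions are not enumerated: cutting [w] down to any set that contains [i] but not [j] gives
    one of the words [z]. *)
Definition entangled_check (n : nat) (f : seq bool -> int) : bool :=
  (f (nseq n false) != 0) &&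
  forall_pairs n (fun i j => has_lazy (fun w =>
    if nth false w i && nth false w j && (f w != 0) then
        all_lazy (fun z => if all2 implb z w && nth false z i && ~~ nth false z j
                        then f z == 0 else true) (words n) else false) (words n)).

(** The exponent sums over the edges of a triangle with a pendant vertex at each corner: this is the
    graph state of that graph, projected onto even parity. *)
Definition amp6 (w : seq bool) : int :=
  let x := nth false w in
  if odd (count id w) then 0 else
  (-1) ^+ ((x 0 && x 1) (+) (x 1 && x 2) (+) (x 0 && x 2)
           (+) (x 0 && x 3) (+) (x 1 && x 4) (+) (x 2 && x 5))%N.

(** With positions read as points of F_2^3, the four checks span the affine functions; the code is
    the self-dual Reed-Muller code RM(1,3). *)
Definition amp8 (w : seq bool) : int :=
  let x := nth false w in
  if [|| x 0 (+) x 1 (+) x 2 (+) x 3, x 4 (+) x 5 (+) x 6 (+) x 7,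
         x 0 (+) x 1 (+) x 4 (+) x 5 | x 0 (+) x 2 (+) x 4 (+) x 6]%N
  then 0 else 1.

Lemma bell_check6 : bell_check 6 amp6.
Proof. by vm_compute. Qed.

Lemma entangled_check6 : entangled_check 6 amp6.
Proof. by vm_compute. Qed.

Lemma strong_bell_check8 : strong_bell_check 8 amp8.
Proof. by vm_compute. Qed.

Lemma entangled_check8 : entangled_check 8 amp8.
Proof. by vm_compute. Qed.

(** * From bit words to vectors on qubits *)

Lemma mem_rest (n i j q : nat) :
  (q \in rest n i j) = [&& q < n, q != i & q != j]%N.
Proof. by rewrite mem_filter mem_iota andbC. Qed.

Definition bits (n : nat) (x : {ffun 'I_n -> bool}) : seq bool :=
  [seq x i | i <- enum 'I_n].

Lemma size_bits (n : nat) (x : {ffun 'I_n -> bool}) : size (bits n x) = n.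
Proof. by rewrite size_map size_enum_ord. Qed.

Lemma nth_bits (n : nat) (x : {ffun 'I_n -> bool}) (i : 'I_n) :
  nth false (bits n x) i = x i.
Proof. by rewrite (nth_map i) ?size_enum_ord // nth_ord_enum. Qed.

Lemma bits_words (n : nat) (x : {ffun 'I_n -> bool}) : bits n x \in words n.
Proof. by rewrite -[X in words X](size_bits n x) mem_words. Qed.

Lemma words_bits (n : nat) (w : seq bool) :
  w \in words n -> exists x, bits n x = w.
Proof.
move=> /size_words w_n; exists [ffun q : 'I_n => nth false w q].
apply: (@eq_from_nth _ false) => [|k]; rewrite size_bits // => kn.
by rewrite -[k]/(nat_of_ord (Ordinal kn)) nth_bits ffunE.
Qed.

Section Bridge.

Variable C : numClosedFieldType.

Definition state (n : nat) (f : seq bool -> int) : qvec C 'I_n :=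
  [ffun x => (f (bits n x))%:~R].

Definition bell (st : bool * bool) : qvec2 C :=
  [ffun p => (bell_amp st p)%:~R].

Lemma bell_statesE : bell_states C = [seq bell st | st <- labels].
Proof.
rewrite /bell_states /labels [RHS]/=.
congr [:: _, _, _ & [:: _]]; apply/ffunP => -[[] []].
all: rewrite !ffunE /bell_amp !xpair_eqE /= ?oppr0 ?addr0 ?add0r.
all: by rewrite ?rmorph_sign ?rmorph0.
Qed.

(** A word on the remaining qubits is represented by its extension with zeros at [i] and [j], which
    avoids renumbering. *)
Lemma bits_extend (n : nat) (i j : 'I_n) (a b : bool)
    (y : {ffun others i j -> bool}) :
  i != j ->
  bits n (extend a b y) = put (bits n (extend false false y)) i j a b.
Proof.
move=> ij; apply: (@eq_from_nth _ false); first by rewrite size_mkseq !size_bits.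
move=> k; rewrite size_bits => kn.
rewrite nth_mkseq ?size_bits // -[k]/(nat_of_ord (Ordinal kn)) !nth_bits.
rewrite !ffunE; case: insubP => [r /andP[/negPf ri /negPf rj] _|].
  by rewrite -!(inj_eq val_inj) /= in ri rj; rewrite ri rj.
rewrite negb_and !negbK -!(inj_eq val_inj) /=.
by case: ifP => // _ /= ->.
Qed.

(** Bell amplitudes are integers, hence fixed by conjugation, and only two of the four terms
    survive. *)
Lemma contract_state (n : nat) (f : seq bool -> int) (i j : 'I_n)
    (st : bool * bool) (y : {ffun others i j -> bool}) :
  i != j ->
  contract (bell st) i j (state n f) y =
  (contract_amp f st i j (bits n (extend false false y)))%:~R.
Proof.
move=> ij; have: forall a b, _ := fun a b => bits_extend n i j a b y ij.
move: (bits n (extend false false y)) => w Ew.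
rewrite !ffunE !big_bool /= !ffunE !rmorph_int !Ew.
rewrite /contract_amp /bell_amp rmorphD rmorphM.
case: st => [[] t] /=; rewrite ?andbT ?andbF expr0 !rmorph0 rmorph1.
  by rewrite !mul0r !mul1r addr0 add0r addrC.
by rewrite !mul0r !mul1r addr0 add0r addrC.
Qed.

End Bridge.

(** * Pairings given by lists of pairs *)

Section Matching.

Variables (n : nat) (i j : 'I_n) (L : seq (nat * nat)).
Hypothesis matchL : is_matching (rest n i j) L.

Definition nat_pair (p : others i j * others i j) : nat * nat :=
  (nat_of_ord (val p.1), nat_of_ord (val p.2)).

Lemma nat_pair_inj : injective nat_pair.
Proof. by move=> [a b] [c d] [/val_inj/val_inj -> /val_inj/val_inj ->]. Qed.

Definition matching_set : {set others i j * others i j} :=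
  [set p | nat_pair p \in L].

Lemma rest_others (q : nat) :
  q \in rest n i j -> exists r : others i j, nat_of_ord (val r) = q.
Proof.
rewrite mem_rest => /and3P[qn qi qj].
have q_others : (Ordinal qn != i) && (Ordinal qn != j).
  by rewrite -!(inj_eq val_inj) /= qi.
by exists (exist _ (Ordinal qn) q_others).
Qed.

Lemma others_rest (q : others i j) : nat_of_ord (val q) \in rest n i j.
Proof. by rewrite mem_rest ltn_ord !(inj_eq val_inj); case: q. Qed.

(** This turns counts and products over the set into those over the list. *)
Lemma perm_matching_set : perm_eq [seq nat_pair p | p <- enum matching_set] L.
Proof.
have /and3P[uniqL /allP L_rest _] := matchL.
apply: uniq_perm => //; first by rewrite (map_inj_uniq nat_pair_inj) enum_uniq.
move=> u; apply/mapP/idP => [[p pM ->]|uL]; first by move: pM; rewrite mem_enum inE.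
have /and3P[_ /rest_others[r1 E1] /rest_others[r2 E2]] := L_rest u uL.
have u_pair : u = nat_pair (r1, r2) by case: u E1 E2 {uL} => u1 u2 /= <- <-.
by exists (r1, r2); rewrite // mem_enum inE -u_pair.
Qed.

Lemma pairing_matching_set : pairing matching_set.
Proof.
have /and3P[_ /allP L_rest /allP L_count] := matchL; split=> [p|q].
  rewrite inE => /L_rest /and3P[+ _ _].
  by apply: contraNN => /eqP p12; rewrite /= p12.
have /eqP <- := L_count _ (others_rest q).
rewrite -(seq.permP perm_matching_set) count_map -size_filter cardE.
rewrite [enum matching_set]/enum_mem -filter_predI.
congr size; apply: eq_filter => p; rewrite /= !inE andbC; congr (_ && _).
Qed.

Lemma pair_tensor_matching_set (C : numClosedFieldType)
    (b : nat * nat -> bool * bool) (y : {ffun others i j -> bool}) :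
  pair_tensor matching_set (fun p => bell C (b (nat_pair p))) y =
  (pairs_amp L b (bits n (extend false false y)))%:~R.
Proof.
have ext (q : others i j) : nth false (bits n (extend false false y)) (val q) = y q.
  by rewrite nth_bits ffunE valK.
rewrite ffunE /pairs_amp foldrE big_map -(perm_big _ perm_matching_set) big_map.
rewrite big_enum rmorph_prod; apply: eq_bigr => p _.
by rewrite ffunE /= !ext.
Qed.

End Matching.

(** * Soundness of the checks *)

Lemma contraction_same_state (C : numClosedFieldType) (n : nat)
    (f : seq bool -> int) (st : bool * bool) (i j : 'I_n) (L : seq (nat * nat))
    (b : nat * nat -> bool * bool) :
  i != j -> is_matching (rest n i j) L -> is_pairs (contraction n f st i j) L b ->
  same_state (contract (bell C st) i j (state C n f))
    (pair_tensor (matching_set n i j L) (fun p => bell C (b (nat_pair n i j p)))).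
Proof.
move=> ij matchL; rewrite /is_pairs has_lazyE => /hasP[c c_in].
rewrite all_lazyE => /allP cE; exists c%:~R => [|y].
  by rewrite intr_eq0; move: c_in; rewrite !inE => /or4P[] /eqP ->.
rewrite contract_state // pair_tensor_matching_set // -rmorphM /=.
congr (_%:~R); apply/eqP.
(* This word vanishes at [i] and [j], so it is among the tabulated ones. *)
set w := bits _ _; apply: (cE (w, contract_amp f st i j w)).
apply/mapP; exists w => //; rewrite mem_filter bits_words !nth_bits.
by rewrite !ffunE !insubF ?eqxx ?andbF // ?(negPf ij) ?if_same.
Qed.

Lemma bell_check_sound (C : numClosedFieldType) (n : nat) (f : seq bool -> int) :
  bell_check n f -> bell_property (state C n f).
Proof.
move=> /forall_pairsP check i j ij phi; rewrite bell_statesE => /mapP[st st_in ->].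
move: (check i j ij); rewrite all_lazyE => /allP/(_ st st_in); cbv beta zeta.
rewrite has_lazyE => /hasP[L _]; case: ifP => // matchL.
rewrite has_lazyE => /hasP[l _].
move=> /(contraction_same_state C _ _ _ _ _ _ _ ij matchL) same.
exists (matching_set n i j L).
exists (fun p => bell C (nth (false, false) l (index (nat_pair n i j p) L))).
split=> [||//]; first exact: pairing_matching_set.
move=> p _; apply: (map_f (bell C)).
(* Every pair of bits is a label, the default value of [nth] included. *)
by case: (nth _ _ _) => [[] []].
Qed.

Lemma strong_bell_check_sound (C : numClosedFieldType) (n : nat)
    (f : seq bool -> int) :
  strong_bell_check n f -> strong_bell_property (state C n f).
Proof.
move=> /forall_pairsP check i j ij phi; rewrite bell_statesE => /mapP[st st_in ->].
move: (check i j ij); rewrite all_lazyE => /allP/(_ st st_in); cbv beta zeta.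
rewrite has_lazyE => /hasP[L _]; case: ifP => // matchL.
move=> /(contraction_same_state C _ _ _ _ _ _ _ ij matchL) same.
by exists (matching_set n i j L); split; first exact: pairing_matching_set.
Qed.

Lemma entangled_check_sound (C : numClosedFieldType) (n : nat)
    (f : seq bool -> int) :
  entangled_check n f -> genuinely_entangled (state C n f).
Proof.
case/andP=> f0 /forall_pairsP check.
have zeroE : bits n [ffun=> false] = nseq n false.
  apply: (@eq_from_nth _ false) => [|k]; rewrite size_bits ?size_nseq // => kn.
  by rewrite -[k]/(nat_of_ord (Ordinal kn)) nth_bits ffunE nth_nseq if_same.
split; first by exists [ffun=> false]; rewrite ffunE intr_eq0 zeroE.
case=> S [S0 ST [Phi [Chi [_ _ prod]]]].
have /set0Pn[i iS] := S0.
have /subsetPn[j _ jS] : ~~ ([set: 'I_n] \subset S) by rewrite subTset.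
have ij : i != j by apply: contraNneq jS => <-.
move: (check i j ij); rewrite has_lazyE => /hasP[w /words_bits[x <-]].
case: ifP => // /andP[/andP[]]; rewrite !nth_bits => xi xj fx.
rewrite all_lazyE => /allP/(_ _ (bits_words n [ffun q => (q \in S) && x q])).
rewrite !nth_bits !ffunE iS xi (negPf jS).
set z := [ffun q => (q \in S) && x q].
have -> : all2 implb (bits n z) (bits n x).
  rewrite all2E !size_bits eqxx zip_map all_map; apply/allP => q _.
  by rewrite /= ffunE; apply/implyP => /andP[].
move=> /eqP fz.
have val_state u : state C n f u = Phi (subword (fun q => q \in S) u)
   * Chi (subword (fun q => q \notin S) u) by rewrite prod ffunE.
have := val_state z.
have -> : subword (fun q => q \in S) z = subword (fun q => q \in S) x.
  by apply/ffunP => q; rewrite !ffunE (valP q).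
have -> : subword (fun q => q \notin S) z =
          subword (fun q => q \notin S) [ffun=> false].
  by apply/ffunP => q; rewrite !ffunE (negPf (valP q)).
have := val_state x; have := val_state [ffun=> false].
(* The vanishing amplitude at [z] is a product whose [Phi] factor also occurs in the amplitude at
   [x] and whose [Chi] factor occurs in the one at zero. *)
rewrite !ffunE fz zeroE => f0E fxE /esym/eqP; rewrite mulf_eq0 => /orP[] /eqP E.
  by move: fx; rewrite -(intr_eq0 C) fxE E mul0r eqxx.
by move: f0; rewrite -(intr_eq0 C) f0E E mulr0 eqxx.
Qed.

Theorem theorem1p13 (R : realType) :
  (exists Psi : qvec R[i] 'I_6, genuinely_entangled Psi /\ bell_property Psi) /\
  (exists Psi : qvec R[i] 'I_8,
     genuinely_entangled Psi /\ strong_bell_property Psi).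
Proof.
split; [exists (state R[i] 6 amp6) | exists (state R[i] 8 amp8)]; split.
- exact: entangled_check_sound entangled_check6.
- exact: bell_check_sound bell_check6.
- exact: entangled_check_sound entangled_check8.
- exact: strong_bell_check_sound strong_bell_check8.
Qed.
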